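(* Let $\mathcal{H}$ be a complex separable Hilbert space, let $\Phi=(\phi_n)_{n=1}^\infty$ and $\Psi=(\psi_n)_{n=1}^\infty$ be frames for $\mathcal{H}$, let $c$ be a non-zero constant and let $m=(m_n)=(c)$ be the constant sequence with all terms $c$. Then the following assertions hold. \begin{itemize} \item[(i)] If $\mathcal{R}(U_\Phi)\subseteq\mathcal{R}(U_\Psi)$, then $M_{(1/c),\widetilde{\Psi},\widetilde{\Phi}}$ is a bounded right inverse of $M_{(c),\Phi,\Psi}$. \item[(ii)] If $\mathcal{R}(U_\Psi)\subseteq\mathcal{R}(U_\Phi)$, then $M_{(1/c),\widetilde{\Psi},\widetilde{\Phi}}$ is a bounded left inverse of $M_{(c),\Phi,\Psi}$. \item[(iii)] If $\mathcal{R}(U_\Phi)=\mathcal{R}(U_\Psi)$, then $M_{(c),\Phi,\Psi}$ is invertible and $M_{(c),\Phi,\Psi}^{-1}=M_{(1/c),\widetilde{\Psi},\widetilde{\Phi}}$. \item[(iv)] If $\mathcal{R}(U_\Phi)\subsetneq\mathcal{R}(U_\Psi)$, then $M_{(c),\Phi,\Psi}$ is not invertible. \item[(v)] If $\mathcal{R}(U_\Psi)\subsetneq\mathcal{R}(U_\Phi)$, then $M_{(c),\Phi,\Psi}$ is not invertible. \end{itemize}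
   Context: A sequence $\Phi=(\phi_n)_{n=1}^\infty$ in $\mathcal{H}$ is a frame for $\mathcal{H}$ if there are $0<A\le B<\infty$ with $A\|h\|^2\le\sum_n|\langle h,\phi_n\rangle|^2\le B\|h\|^2$ for all $h\in\mathcal{H}$. For a frame $\Phi$: the analysis operator is $U_\Phi:\mathcal{H}\to\ell^2$, $U_\Phi h=(\langle h,\phi_n\rangle)_n$, with range $\mathcal{R}(U_\Phi)$; the frame operator is $S_\Phi h=\sum_n\langle h,\phi_n\rangle\phi_n$, a bounded bijection of $\mathcal{H}$; the canonical dual is $\widetilde{\Phi}=(\widetilde{\phi}_n)=(S_\Phi^{-1}\phi_n)$. For a complex sequence $m$ and sequences $\Phi,\Psi$ in $\mathcal{H}$, the multiplier is $M_{m,\Phi,\Psi}h=\sum_{n=1}^\infty m_n\langle h,\psi_n\rangle\phi_n$ (inner product linear in the first argument); it is a well-defined bounded operator on $\mathcal{H}$ when $m\in\ell^\infty$ and $\Phi,\Psi$ are frames. $(c)$ and $(1/c)$ denote constant sequences. An operator $\mathcal{H}\to\mathcal{H}$ is invertible if it is a bounded bijection of $\mathcal{H}$ onto $\mathcal{H}$. *)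

(* Defs.v *)
From HB Require Import structures.
From mathcomp Require Import all_boot all_order all_algebra complex.
From mathcomp Require Import all_classical all_reals all_analysis.
Set Implicit Arguments.
Unset Strict Implicit.
Unset Printing Implicit Defensive.
Import Order.TTheory GRing.Theory Num.Theory.
Import numFieldNormedType.Exports.
Local Open Scope classical_set_scope.
Local Open Scope complex_scope.
Local Open Scope ring_scope.

Definition separable_space (T : topologicalType) : Prop :=
  exists2 D : set T, countable D & dense D.

Section Operators.
Context {R : realType} {H : normedModType R[i]}.
Implicit Types T N : H -> H.

Definition bounded_operator T : Prop :=
  linear T /\ exists K : R, forall h, `|T h| <= K%:C * `|h|.

Definition invertible T : Prop := bounded_operator T /\ bijective T.

(* The inverse function of a bijection; unspecified off the range of [T]. *)
Definition inv_op T : H -> H := 'pinv_(fun=> 0) setT T.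

Definition bounded_right_inverse T N : Prop :=
  bounded_operator N /\ forall h, T (N h) = h.

Definition bounded_left_inverse T N : Prop :=
  bounded_operator N /\ forall h, N (T h) = h.

End Operators.

Section Frames.
Context {R : realType} {H : completeNormedModType R[i]}.

(* [{dot _ for _}] makes the form definite, linear in its first argument and
   conjugate-linear in its second one. *)
Context (dot : {dot H for @Num.conj R[i]}).
Implicit Types Phi Psi : nat -> H.

(* The form induces the given (complete) norm of [H]. *)
Definition hilbert_dot : Prop := forall h : H, `|h| ^+ 2 = dot h h.

Definition is_frame Phi : Prop :=
  exists A B : R, [/\ 0 < A, A <= B & forall h : H,
    let s : nat -> R[i]^o := series (fun n => `|dot h (Phi n)| ^+ 2) in
    [/\ cvgn s, A%:C * `|h| ^+ 2 <= limn s & limn s <= B%:C * `|h| ^+ 2]].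

(* For a frame the values lie in l^2, so [range (analysis Phi)], taken among
   all complex sequences (indexed from 0), is the range of the operator into l^2. *)
Definition analysis Phi (h : H) : nat -> R[i] := fun n => dot h (Phi n).

(* [limn] is total, with an arbitrary value at divergent sequences; the series
   below converge as soon as the sequences of vectors are frames and [m] is
   bounded. *)
Definition frame_op Phi (h : H) : H :=
  limn (series (fun n => dot h (Phi n) *: Phi n)).

Definition canonical_dual Phi : nat -> H := fun n => inv_op (frame_op Phi) (Phi n).

Definition multiplier (m : nat -> R[i]) Phi Psi (h : H) : H :=
  limn (series (fun n => (m n * dot h (Psi n)) *: Phi n)).

End Frames.

(* Main.v *)
Require Import Defs.
From HB Require Import structures.
From mathcomp Require Import all_boot all_order all_algebra complex.
From mathcomp Require Import all_classical all_reals all_analysis.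
From mathcomp Require Import ring lra.
Set Implicit Arguments.
Unset Strict Implicit.
Unset Printing Implicit Defensive.
Import Order.TTheory GRing.Theory Num.Theory.
Import numFieldNormedType.Exports.
Local Open Scope classical_set_scope.
Local Open Scope complex_scope.
Local Open Scope ring_scope.

(* Write [M] and [N] for the multipliers of the frames and of the duals, [T_F]
   for the synthesis operator [a |-> \sum_n a_n F_n], [U_F] for the analysis
   operator and [S_F = T_F U_F]. Since [S_F] is self-adjoint, [U_F~ = U_F
   S_F^-1] and [T_F~ = S_F^-1 T_F], so that, up to the scalar, [M = T_Phi
   U_Psi] and [N = S_Psi^-1 T_Psi U_Phi S_Phi^-1]. As soon as [U_Psi k =
   U_Phi g], [T_Phi U_Psi k = S_Phi g] and [T_Psi U_Phi g = S_Psi k]; an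
   inclusion of ranges provides [k] or [g] and everything telescopes. In the
   strict cases, invertibility of [M] would make [N] a two-sided inverse,
   and the same computation then yields the reverse inclusion. Invertibility
   of [S_F] is a Neumann series: with frame bounds [A <= B], the operator [1
   - S_F / B] is a contraction, because [|S_F h|^2 <= B <S_F h, h>]. *)

(** * Limits, series and scalar inequalities *)

(** The order of [K] may be partial, as on [R[i]]. Nonnegativity survives limits because a
    nonnegative sequence equals the sequence of its norms, so its limit is the norm of that
    limit. *)
Lemma ler_cvg (K : numFieldType) (u v : nat -> K^o) (a b : K^o) :
  u @ \oo --> a -> v @ \oo --> b -> (forall n, u n <= v n) -> a <= b.
Proof.
move=> ua vb uv; rewrite -subr_ge0.
have h : (v - u) @ \oo --> b - a by exact: cvgB.
have h2 : (v - u) @ \oo --> (`|b - a| : K^o).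
  have -> : v - u = fun n => `|(v - u) n|.
    by apply/funext => n /=; rewrite ger0_norm// subr_ge0.
  exact: (cvg_norm (V := K^o) h).
by rewrite (cvg_unique _ h h2).
Qed.

Lemma lipschitz_continuous (K : numFieldType) (V W : normedModType K)
    (f : V -> W) (k : K) : 0 <= k ->
  (forall x y, `|f x - f y| <= k * `|x - y|) -> continuous f.
Proof.
move=> k0 fk x; apply/(@cvgrPdist_lt _ _ _ (nbhs x)) => e e0.
near=> y; apply: (le_lt_trans (fk _ _)).
rewrite (@le_lt_trans _ _ ((k + 1) * `|x - y|))//.
  by rewrite ler_wpM2r// lerDl.
rewrite -ltr_pdivlMl ?ltr_wpDl//.
near: y; apply: cvgr_dist_lt => //.
by rewrite mulr_gt0// invr_gt0 ltr_wpDl.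
Unshelve. all: by end_near. Qed.

Lemma is_cvg_series_dominated (R : realType) (H : completeNormedModType R[i])
    (u : nat -> H) (a : nat -> R) :
  (forall n, `|u n| <= (a n)%:C) -> cvgn (series a) -> cvgn (series u).
Proof.
move=> ua /cauchy_cvgP/cauchy_seriesP ca.
apply/cauchy_cvgP/cauchy_seriesP => e e0.
(* A positive element of [R[i]] is real, so the tolerance descends to [R], where [series a] is
   Cauchy. *)
have er : e = (complex.Re e)%:C by rewrite RRe_real// gtr0_real.
have re0 : 0 < complex.Re e by rewrite -ltcR -er.
apply: filterS (ca _ re0) => -[m n] /= smn.
rewrite er; apply: le_lt_trans (ler_norm_sum _ _ _) _.
apply: (@le_lt_trans _ _ (\sum_(m <= k < n) a k)%:C); last first.
  by rewrite ltcR; apply: le_lt_trans smn; exact: ler_norm.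
by rewrite rmorph_sum; apply: ler_sum.
Qed.

Lemma ge0_series_le_lim (K : numFieldType) (u : nat -> K^o) m n :
  (forall k, 0 <= u k) -> cvgn (series u) ->
  \sum_(m <= k < n) u k <= limn (series u).
Proof.
move=> u0 cu; have nd : forall i j, (i <= j)%N -> series u i <= series u j.
  by move=> i j ij; rewrite -subr_ge0 sub_series_geq// sumr_ge0.
apply: (@le_trans _ _ (series u n)).
  have [mn|/ltnW nm] := leqP m n; last by rewrite big_geq// sumr_ge0.
  by rewrite -sub_series_geq// gerBl sumr_ge0.
(* The shift by [n] keeps the limit and makes the comparison hold at every index, as [ler_cvg]
   asks. *)
apply: (@ler_cvg _ (fun=> series u n) (fun k => series u (k + n)%N)).
- exact: cvg_cst.
- by have := cu; rewrite -(cvg_shiftn n).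
- by move=> k; rewrite nd// leq_addl.
Qed.

Lemma weighted_AMGM (K : numFieldType) (b x y : K) :
  0 < b -> 0 <= x -> 0 <= y -> x * y *+ 2 <= b * x ^+ 2 + b^-1 * y ^+ 2.
Proof.
move=> b0 x0 y0.
have xr : b * x - y \is Num.real.
  by apply: realB; apply: ger0_real => //; rewrite mulr_ge0// ltW.
have ge : 0 <= b^-1 * (b * x - y) ^+ 2.
  by rewrite mulr_ge0 ?invr_ge0 ?real_exprn_even_ge0// ltW.
rewrite -subr_ge0; suff <- : b^-1 * (b * x - y) ^+ 2 =
  b * x ^+ 2 + b^-1 * y ^+ 2 - x * y *+ 2 by [].
by field; rewrite gt_eqF.
Qed.

(** With [x = |h|], [y = |S h|] and [d = <S h, h>], the left side is the expansion of
    [|h - S h / B|^2]. The bound on [y] absorbs the quadratic term into one copy of [d / B]; the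
    other copy is at least [A x^2 / B], and [1 - A / B <= (1 - A / (2 B))^2]. *)
Lemma contraction_estimate (R : realFieldType) (A B x y d : R) :
  0 < A -> 0 < B -> 0 <= d -> A * x ^+ 2 <= d -> y ^+ 2 <= B * d ->
  x ^+ 2 - B^-1 * d - (B^-1 * d - B^-1 * (B^-1 * y ^+ 2))
    <= (1 - A / (2 * B)) ^+ 2 * x ^+ 2.
Proof.
move=> A0 B0 d0 Ax yB; set u := B^-1.
have u0 : 0 < u by rewrite invr_gt0.
have uB : u * B = 1 by rewrite mulVf ?gt_eqF.
have -> : A / (2 * B) = A * u / 2 by rewrite invfM -/u; ring.
have h1 : u * (u * y ^+ 2) <= u * d.
  by rewrite (ler_wpM2l (ltW u0))// -[leRHS]mul1r -uB -mulrA (ler_wpM2l (ltW u0)).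
have h2 : u * (A * x ^+ 2) <= u * d by rewrite (ler_wpM2l (ltW u0)).
have h3 : 0 <= (A * u / 2 * x) ^+ 2 by exact: sqr_ge0.
nra.
Qed.

(** * Inner product and bounded operators *)

Section HilbertSpace.
Context (R : realType) (H : completeNormedModType R[i]).
Context (dot : {dot H for @Num.conj R[i]}) (dotH : hilbert_dot dot).
Local Notation C := R[i].

Lemma dotDl u v w : dot (u + v) w = dot u w + dot v w.
Proof. exact: linearDl. Qed.
Lemma dotBl u v w : dot (u - v) w = dot u w - dot v w.
Proof. exact: linearBl. Qed.
Lemma dotZl a u w : dot (a *: u) w = a * dot u w.
Proof. exact: linearZl_LR. Qed.
Lemma dotBr u v w : dot w (u - v) = dot w u - dot w v.
Proof. exact: linearBr. Qed.
Lemma dotZr a u w : dot w (a *: u) = a^* * dot w u.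
Proof. exact: linearZr_LR. Qed.
Lemma dotC u v : dot u v = (dot v u)^*.
Proof. by have := hermC dot u v; rewrite expr0 mul1r. Qed.
Lemma dot_suml (I : Type) (r : seq I) (F : I -> H) w :
  dot (\sum_(i <- r) F i) w = \sum_(i <- r) dot (F i) w.
Proof. exact: linear_sumlz. Qed.

Lemma norm_dotC u v : `|dot u v| = `|dot v u|.
Proof. by rewrite dotC norm_conjC. Qed.

Lemma cauchy_schwarz u v : `|dot u v| <= `|u| * `|v|.
Proof.
have [->|v0] := eqVneq v 0.
  by rewrite (linear0r dot) !normr0 mulr0.
have nv : 0 < `|v| ^+ 2 by rewrite exprn_gt0 ?normr_gt0.
rewrite -(@ler_pXn2r _ 2)// ?nnegrE ?mulr_ge0// exprMn.
rewrite -(ler_pM2l nv) -subr_ge0.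
set d := dot u v.
(* This vector is [|v|^2] times the component of [u] orthogonal to [v]; the scaling avoids a
   division, and its squared norm is [|v|^2] times the difference to be shown nonnegative. *)
have : 0 <= `|(`|v| ^+ 2) *: u - d *: v| ^+ 2 by rewrite exprn_ge0.
rewrite dotH dotBl !dotBr !dotZl !dotZr (dotC v u) -!dotH -/d normCK.
rewrite (CrealP _) ?ger0_real ?exprn_ge0//.
by congr (_ <= _); ring.
Qed.

Lemma dot_continuousl v : continuous (fun u => dot u v : C^o).
Proof.
apply: (@lipschitz_continuous _ _ _ _ `|v|) => // x y.
by rewrite -dotBl mulrC cauchy_schwarz.
Qed.

Lemma dot_continuousr v : continuous (dot v : H -> C^o).
Proof.
apply: (@lipschitz_continuous _ _ _ _ `|v|) => // x y.
by rewrite -dotBr cauchy_schwarz.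
Qed.

Lemma bounded_operator_continuous (T : H -> H) :
  bounded_operator T -> continuous T.
Proof.
move=> [lT [K TK]]; apply: (@lipschitz_continuous _ _ _ _ (`|K|%:C)) => [|x y].
  by rewrite ler0c.
have -> : T x - T y = T (x - y).
  by rewrite addrC -scaleN1r -lT scaleN1r addrC.
apply: (le_trans (TK _)); rewrite ler_wpM2r// lecR; exact: ler_norm.
Qed.

Lemma bounded_operator0 (T : H -> H) : bounded_operator T -> T 0 = 0.
Proof.
by move=> [lT _]; have := lT (-1) 0 0; rewrite scaler0 addr0 scaleN1r addNr.
Qed.

Lemma bounded_operatorZr (T : H -> H) (c : C) h :
  bounded_operator T -> T (c *: h) = c *: T h.
Proof.
move=> bT; have [lT _] := bT.
by have := lT c h 0; rewrite (bounded_operator0 bT) !addr0.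
Qed.

Lemma bounded_operatorZ (T : H -> H) (c : C) :
  bounded_operator T -> bounded_operator (fun h => c *: T h).
Proof.
move=> [lT [K TK]]; split=> [k x y|].
  by rewrite lT scalerDr !scalerA mulrC.
have [a ca] := complex_realP _ (normr_real c).
exists (a * K) => h; rewrite normrZ rmorphM -mulrA ca ler_wpM2l//.
by rewrite -ca.
Qed.

Lemma bounded_operator_comp (T U : H -> H) :
  bounded_operator T -> bounded_operator U -> bounded_operator (T \o U).
Proof.
move=> [lT [K TK]] [lU [L UL]]; split=> [k x y|]; first by rewrite /= lU lT.
(* [K] may be negative when [H] is trivial, hence the absolute value. *)
exists (`|K| * L) => h; apply: (le_trans (TK _)).
apply: (@le_trans _ _ (`|K|%:C * `|U h|)).
  by rewrite ler_wpM2r// lecR ler_norm.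
by rewrite rmorphM -mulrA ler_wpM2l// ler0c.
Qed.

(** * Synthesis and analysis for Bessel sequences and frames *)

Definition sqsummable (a : nat -> C) :=
  cvgn (series (fun n => `|a n| ^+ 2) : nat -> C^o).

Definition synthesis (F : nat -> H) (a : nat -> C) : H :=
  limn (series (fun n => a n *: F n)).

Section Bessel.
Variables (F : nat -> H) (B : R).
Hypotheses (B0 : 0 < B) (sqF : forall h, sqsummable (analysis dot F h)).
Hypothesis (leF : forall h, limn
  (series (fun n => `|dot h (F n)| ^+ 2) : nat -> C^o) <= B%:C * `|h| ^+ 2).

Let bB0 : 0 < B%:C. Proof. by rewrite ltcR. Qed.

(** Pair the partial sum [v] with itself: [|v|^2] is the sum of the [a_k <F_k, v>]. AM-GM with
    weight [B] splits it into the target sum and [B^-1] times the sum of [|<v, F_k>|^2], which the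
    Bessel bound absorbs into [|v|^2]. *)
Lemma norm_synthesis_part a m n :
  `|\sum_(m <= k < n) a k *: F k| ^+ 2 <= B%:C * \sum_(m <= k < n) `|a k| ^+ 2.
Proof.
set v := \sum_(m <= k < n) _; set s := \sum_(m <= k < n) _.
suff : `|v| ^+ 2 *+ 2 <= B%:C * s + `|v| ^+ 2 by rewrite mulr2n lerD2r.
have h1 : `|v| ^+ 2 *+ 2 <=
    \sum_(m <= k < n) (B%:C * `|a k| ^+ 2 + B%:C^-1 * `|dot v (F k)| ^+ 2).
  rewrite -[leLHS]ger0_norm ?mulrn_wge0 ?exprn_ge0// dotH {1}/v dot_suml -sumrMnl.
  apply: (le_trans (ler_norm_sum _ _ _)); apply: ler_sum => k _.
  rewrite dotZl normrMn normrM norm_dotC -/v.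
  exact: weighted_AMGM.
apply: (le_trans h1); rewrite big_split/= -!mulr_sumr lerD2l.
rewrite ler_pdivrMl// (le_trans _ (leF v))//.
by apply: ge0_series_le_lim => [k|]; [exact: exprn_ge0|exact: sqF].
Qed.

Lemma is_cvg_synthesis a : sqsummable a -> cvgn (series (fun n => a n *: F n)).
Proof.
move=> /cvg_cauchy/cauchy_seriesP ca.
apply/cauchy_cvgP/cauchy_seriesP => e e0.
have e20 : 0 < e ^+ 2 / B%:C by rewrite divr_gt0 ?exprn_gt0.
apply: filterS (ca _ e20) => -[m n] /= smn.
rewrite -(@ltr_pXn2r _ 2)// ?nnegrE ?normr_ge0 ?ltW//.
apply: (le_lt_trans (norm_synthesis_part _ _ _)).
rewrite -ltr_pdivlMl// mulrC; apply: le_lt_trans smn.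
by rewrite ger0_norm// sumr_ge0// => k _; rewrite exprn_ge0.
Qed.

Lemma norm_synthesis a : sqsummable a -> `|synthesis F a| ^+ 2 <=
  B%:C * limn (series (fun n => `|a n| ^+ 2) : nat -> C^o).
Proof.
move=> sa; have ca := is_cvg_synthesis sa.
have cn : (fun n => `|series (fun n => a n *: F n) n| ^+ 2 : C^o) @ \oo -->
    (`|synthesis F a| ^+ 2 : C^o).
  rewrite expr2; under eq_fun do rewrite expr2.
  by apply: cvgM; apply: cvg_norm.
have cB : (fun n => B%:C * series (fun n => `|a n| ^+ 2) n : C^o) @ \oo -->
    (B%:C * limn (series (fun n => `|a n| ^+ 2) : nat -> C^o) : C^o).
  exact: cvgM (cvg_cst _) sa.
by apply: (ler_cvg cn cB) => n; exact: norm_synthesis_part.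
Qed.

End Bessel.

Lemma frame_sqsummable F h : is_frame dot F -> sqsummable (analysis dot F h).
Proof. by move=> [A [B [_ _ /(_ h)[]]]]. Qed.
Arguments frame_sqsummable {F} h _.

Lemma frame_upper_bound F : is_frame dot F -> exists2 B : R, 0 < B &
  forall h, limn (series (fun n => `|dot h (F n)| ^+ 2) : nat -> C^o)
    <= B%:C * `|h| ^+ 2.
Proof.
move=> [A [B [A0 AB fr]]]; exists B; first exact: lt_le_trans AB.
by move=> h; have [] := fr h.
Qed.

Lemma is_cvg_frame_synthesis F a : is_frame dot F -> sqsummable a ->
  cvgn (series (fun n => a n *: F n)).
Proof.
move=> fr; have [B B0 leB] := frame_upper_bound fr.
by apply: (is_cvg_synthesis B0) => // h; exact: frame_sqsummable.
Qed.

Lemma cross_bounded_operator F G : is_frame dot F -> is_frame dot G ->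
  bounded_operator (fun h => synthesis F (analysis dot G h)).
Proof.
move=> frF frG; split.
  move=> k x y; have cx h := is_cvg_frame_synthesis frF (frame_sqsummable h frG).
  rewrite /= {1}/synthesis; apply: cvg_lim; first exact: norm_hausdorff.
  rewrite (_ : series _ = k *: series (fun n => analysis dot G x n *: F n) +
      series (fun n => analysis dot G y n *: F n)); last first.
    rewrite -seriesZ -seriesD; congr series; apply/funext => n.
    by rewrite /analysis dotDl dotZl scalerDl -scalerA.
  exact: cvgD (cvgZl_tmp (cx x)) (cx y).
have [B B0 leB] := frame_upper_bound frF; have [D D0 leD] := frame_upper_bound frG.
(* The two Bessel bounds give [B D |h|^2] for the squared norm; [B D <= (B + D)^2] spares a square
   root. *)
exists (B + D) => h.
have BD0 : 0 <= (B + D)%:C by rewrite ler0c addr_ge0// ltW.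
rewrite -(@ler_pXn2r _ 2)// ?nnegrE ?mulr_ge0// exprMn.
have sF k : sqsummable (analysis dot F k) by exact: frame_sqsummable.
apply: (le_trans (norm_synthesis B0 sF leB (frame_sqsummable h frG))).
apply: (@le_trans _ _ (B%:C * (D%:C * `|h| ^+ 2))).
  by rewrite ler_wpM2l ?ler0c ?leD// ltW.
rewrite mulrA ler_wpM2r ?exprn_ge0// -rmorphM -rmorphXn lecR.
by nra.
Qed.

(** * The frame operator: self-adjointness, lower bound, Neumann series *)

Section FrameOperator.
Variables (F : nat -> H) (frF : is_frame dot F).
Local Notation S := (frame_op dot F).

Lemma frame_op_bounded : bounded_operator S.
Proof. exact: cross_bounded_operator. Qed.

Lemma cvg_dot_frame_op h g :
  (series (fun n => dot h (F n) * dot (F n) g) : nat -> C^o) @ \oo -->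
  (dot (S h) g : C^o).
Proof.
have c := is_cvg_frame_synthesis frF (frame_sqsummable h frF).
have -> : (series (fun n => dot h (F n) * dot (F n) g) : nat -> C^o) =
    (fun n => dot (series (fun n => dot h (F n) *: F n) n) g).
  by apply/funext => n; rewrite dot_suml; apply: eq_bigr => k _; rewrite dotZl.
exact: cvg_comp c (@dot_continuousl g (S h)).
Qed.

(** By continuity of the form in each argument, both sides are limits of the series of
    [<h, F_n> <F_n, g>]. *)
Lemma frame_op_selfadjoint h g : dot (S h) g = dot h (S g).
Proof.
have c := is_cvg_frame_synthesis frF (frame_sqsummable g frF).
suff e : (series (fun n => dot h (F n) * dot (F n) g) : nat -> C^o) @ \oo -->
    (dot h (S g) : C^o).
  exact: (cvg_unique (@norm_hausdorff _ _) (@cvg_dot_frame_op h g) e).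
have -> : (series (fun n => dot h (F n) * dot (F n) g) : nat -> C^o) =
    (fun n => dot h (series (fun n => dot g (F n) *: F n) n)).
  apply/funext => n; rewrite [RHS]dotC dot_suml rmorph_sum.
  by apply: eq_bigr => k _; rewrite (dotC h) (dotC (F k) g) dotZl rmorphM mulrC.
exact: cvg_comp c (@dot_continuousr h (S g)).
Qed.

Lemma dot_frame_op_diag h :
  dot (S h) h = limn (series (fun n => `|dot h (F n)| ^+ 2) : nat -> C^o).
Proof.
apply/esym/cvg_lim; first exact: norm_hausdorff.
suff <- : (series (fun n => dot h (F n) * dot (F n) h) : nat -> C^o) =
    series (fun n => `|dot h (F n)| ^+ 2) by exact: cvg_dot_frame_op.
by apply/funext => n; apply: eq_bigr => k _; rewrite normCK (dotC (F k)).
Qed.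

(** Cauchy-Schwarz applied to [A |h|^2 <= <S h, h>]. *)
Lemma frame_op_lower : exists2 A : R, 0 < A & forall h, A%:C * `|h| <= `|S h|.
Proof.
have [A [B [A0 _ fr]]] := frF; exists A => // h.
have [->|h0] := eqVneq h 0; first by rewrite normr0 mulr0.
rewrite -(@ler_pM2r _ `|h|) ?normr_gt0// -mulrA -expr2.
have [_ lo _] := fr h; apply: (le_trans lo).
rewrite -dot_frame_op_diag; apply: le_trans (cauchy_schwarz _ _).
have le0 : 0 <= dot (S h) h.
  by rewrite dot_frame_op_diag (le_trans _ lo)// mulr_ge0 ?ler0c ?exprn_ge0// ltW.
by rewrite ger0_norm.
Qed.

Lemma frame_op_contraction : exists t q : R, [/\ 0 <= q, q < 1 &
  forall h, `|h - t%:C *: S h| <= q%:C * `|h| ].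
Proof.
have [A [B [A0 AB fr]]] := frF; have B0 : 0 < B := lt_le_trans A0 AB.
(* The square of [1 - A / (2 B)] exceeds [1 - A / B]: no square root is needed. *)
exists B^-1, (1 - A / (2 * B)); split.
- rewrite subr_ge0 ler_pdivrMr; lra.
- by rewrite ltrBlDr ltrDl divr_gt0// mulr_gt0.
move=> h; have [sh lo up] := fr h.
have q0 : 0 <= 1 - A / (2 * B) by rewrite subr_ge0 ler_pdivrMr; lra.
rewrite -(@ler_pXn2r _ 2)// ?nnegrE ?mulr_ge0 ?ler0c// exprMn.
(* [S h] is the synthesis of the coefficients [<h, F_n>], whose sum of squared moduli is
   [<S h, h>]. *)
have SB : `|S h| ^+ 2 <= B%:C * dot (S h) h.
  rewrite dot_frame_op_diag.
  apply: (norm_synthesis B0 (fun g => frame_sqsummable g frF) _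
    (frame_sqsummable h frF)) => g.
  by case: (fr g).
have lo' : A%:C * `|h| ^+ 2 <= dot (S h) h by rewrite dot_frame_op_diag.
rewrite dotH dotBl !dotBr !dotZl !dotZr -frame_op_selfadjoint -!dotH.
rewrite conj_Creal; last by apply/complex_realP; exists B^-1.
have d0 : 0 <= dot (S h) h by apply: le_trans lo'; rewrite mulr_ge0 ?ler0c// ltW.
(* All three quantities are real, so the inequality descends to [R], where [contraction_estimate]
   applies. *)
have [d de] := complex_realP _ (ger0_real d0).
have [x xe] := complex_realP _ (normr_real h).
have [y ye] := complex_realP _ (normr_real (S h)).
move: lo' SB; rewrite de xe ye -!(rmorphXn, rmorphM, rmorphB) !lecR => lo' SB.
have {}d0 : 0 <= d by rewrite -ler0c -de.
exact: contraction_estimate.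
Qed.

Lemma frame_op_surjective y : exists x, S x = y.
Proof.
have [t [q [q0 q1 ctr]]] := frame_op_contraction.
(* The Neumann terms [(1 - t S)^n y]; the contraction makes them decay geometrically, so [series r]
   converges. *)
pose r n := iter n (fun h => h - t%:C *: S h) y.
have rn n : `|r n| <= (geometric (complex.Re `|y|) q n)%:C.
  elim: n => [|n IH]; first by rewrite /= mulr1 RRe_real.
  apply: (le_trans (ctr _)).
  rewrite /geometric/= exprSr mulrA [X in _ <= X]rmorphM mulrC.
  by rewrite ler_wpM2r// ler0c.
have qlt : `|q| < 1 by rewrite ger0_norm.
have cr : cvgn (series r).
  exact: is_cvg_series_dominated rn (is_cvg_geometric_series qlt).
have [Slin _] := frame_op_bounded.
have S0 := bounded_operator0 frame_op_bounded.
(* Since [r n - r n.+1 = t S (r n)], the sum telescopes; as [r n] tends to 0, the limit of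
   [t *: series r] is a preimage of [y]. *)
have telS n : y - r n = t%:C *: S (series r n).
  elim: n => [|n IH]; first by rewrite /series/= big_geq// S0 scaler0 subrr.
  rewrite seriesS -[X in S (X + _)]scale1r Slin scale1r scalerDr -IH /r/= -/(r n).
  by rewrite opprB addrCA.
exists (t%:C *: limn (series r)).
have tS : t%:C *: S (limn (series r)) = y.
  have c1 : t%:C \*: (S \o series r) @ \oo --> t%:C *: S (limn (series r)).
    apply: cvgZl_tmp.
    exact: cvg_comp cr (@bounded_operator_continuous _ frame_op_bounded _).
  have c2 : (fun n => y - r n) @ \oo --> y - 0.
    by apply: cvgB; [exact: cvg_cst|exact: cvg_series_cvg_0].
  rewrite subr0 in c2.
  have e : (fun n => y - r n) = t%:C \*: (S \o series r).
    by apply/funext => n; rewrite telS.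
  rewrite e in c2.
  exact: (cvg_unique (@norm_hausdorff _ _) c1 c2).
by rewrite (bounded_operatorZr _ _ frame_op_bounded).
Qed.

(** * Inverse of the frame operator and the canonical dual *)

Local Notation Sinv := (inv_op S).

Lemma frame_op_injective : injective S.
Proof.
have [A A0 SA] := frame_op_lower; have [Slin _] := frame_op_bounded.
move=> x y Sxy; apply/eqP; rewrite -subr_eq0 -normr_le0.
have A0' : 0 < A%:C by rewrite ltcR.
rewrite -(ler_pM2l A0') mulr0; apply: (le_trans (SA _)).
by rewrite addrC -scaleN1r Slin scaleN1r Sxy addNr normr0.
Qed.

Lemma frame_opK : cancel S Sinv.
Proof.
by move=> x; rewrite /inv_op pinvKV ?inE//; move=> ? ? _ _; exact: frame_op_injective.
Qed.

Lemma frame_opKV : cancel Sinv S.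
Proof. by move=> y; have [x <-] := frame_op_surjective y; rewrite frame_opK. Qed.

Lemma inv_frame_op_bounded : bounded_operator Sinv.
Proof.
have [Slin _] := frame_op_bounded; split.
  by move=> k x y; apply: frame_op_injective; rewrite Slin !frame_opKV.
have [A A0 SA] := frame_op_lower; exists A^-1 => h.
by rewrite fmorphV ler_pdivlMl ?ltcR// -[in leRHS](frame_opKV h).
Qed.

(** Write [h] as [S (Sinv h)] and move [S] across the form, where it cancels the [Sinv] of the
    dual. *)
Lemma analysis_canonical_dual h :
  analysis dot (canonical_dual dot F) h = analysis dot F (Sinv h).
Proof.
apply/funext => n; rewrite /analysis /canonical_dual.
by rewrite -{1}(frame_opKV h) frame_op_selfadjoint frame_opKV.
Qed.

(** [Sinv] is linear on partial sums and continuous. Convergence thus follows without showing that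
    the dual is itself a frame. *)
Lemma synthesis_canonical_dual a : sqsummable a ->
  (series (fun n => a n *: canonical_dual dot F n)) @ \oo --> Sinv (synthesis F a).
Proof.
move=> sa; have ca := is_cvg_frame_synthesis frF sa.
have [lin _] := inv_frame_op_bounded.
have inv0 := bounded_operator0 inv_frame_op_bounded.
have -> : series (fun n => a n *: canonical_dual dot F n) =
    Sinv \o series (fun n => a n *: F n).
  apply/funext; elim=> [|n IH]; first by rewrite /= /series/= !big_geq// inv0.
  by rewrite /= !seriesS lin IH.
exact: cvg_comp ca
  (@bounded_operator_continuous _ inv_frame_op_bounded (synthesis F a)).
Qed.

End FrameOperator.

(** * Multipliers with constant symbol *)

Lemma multiplier_cst c F G h : is_frame dot F -> is_frame dot G ->
  multiplier dot (fun=> c) F G h = c *: synthesis F (analysis dot G h).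
Proof.
move=> frF frG; have cvF := is_cvg_frame_synthesis frF (frame_sqsummable h frG).
rewrite /multiplier; apply: cvg_lim; first exact: norm_hausdorff.
rewrite (_ : series _ = c *: series (fun n => analysis dot G h n *: F n)).
  exact: cvgZl_tmp cvF.
by rewrite -seriesZ; congr series; apply/funext => n; rewrite -scalerA.
Qed.

Lemma multiplier_cst_dual c F G h : is_frame dot F -> is_frame dot G ->
  multiplier dot (fun=> c) (canonical_dual dot F) (canonical_dual dot G) h =
  c *: inv_op (frame_op dot F)
         (synthesis F (analysis dot G (inv_op (frame_op dot G) h))).
Proof.
move=> frF frG; have sG := frame_sqsummable (inv_op (frame_op dot G) h) frG.
have cv := synthesis_canonical_dual frF sG.
rewrite /multiplier; apply: cvg_lim; first exact: norm_hausdorff.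
rewrite (_ : series _ = c *: series (fun n =>
  analysis dot G (inv_op (frame_op dot G) h) n *: canonical_dual dot F n)).
  exact: cvgZl_tmp cv.
rewrite -seriesZ -analysis_canonical_dual//.
by congr series; apply/funext => n; rewrite -scalerA.
Qed.

End HilbertSpace.

Theorem proposition4p3 (R : realType) (H : completeNormedModType R[i])
    (dot : {dot H for @Num.conj R[i]}) (dotH : hilbert_dot dot)
    (sepH : separable_space H) (Phi Psi : nat -> H)
    (frPhi : is_frame dot Phi) (frPsi : is_frame dot Psi)
    (c : R[i]) (c_neq0 : c != 0) :
  let RU (F : nat -> H) : set (nat -> R[i]) := range (analysis dot F) in
  let M : H -> H := multiplier dot (fun=> c) Phi Psi in
  let N : H -> H := multiplier dot (fun=> 1 / c)
    (canonical_dual dot Psi) (canonical_dual dot Phi) in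
  (RU Phi `<=` RU Psi -> bounded_right_inverse M N) /\
  (RU Psi `<=` RU Phi -> bounded_left_inverse M N) /\
  (RU Phi = RU Psi -> invertible M /\ inv_op M = N) /\
  (RU Phi `<` RU Psi -> ~ invertible M) /\
  (RU Psi `<` RU Phi -> ~ invertible M).
Proof.
move=> RU M N.
pose SF := frame_op dot Phi; pose SG := frame_op dot Psi.
pose U F := analysis dot F.
have SFK := frame_opK dotH frPhi; have SFKV := frame_opKV dotH frPhi.
have SGK := frame_opK dotH frPsi; have SGKV := frame_opKV dotH frPsi.
have ME h : M h = c *: synthesis Phi (U Psi h) by exact: multiplier_cst.
have NE h : N h = (1 / c) *: inv_op SG (synthesis Psi (U Phi (inv_op SF h))).
  exact: multiplier_cst_dual.
have bM : bounded_operator M.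
  rewrite (funext ME); apply: bounded_operatorZ.
  exact: cross_bounded_operator.
have bN : bounded_operator N.
  rewrite (funext NE); apply: bounded_operatorZ.
  apply: bounded_operator_comp; first exact: inv_frame_op_bounded.
  apply: (bounded_operator_comp (T := fun h => synthesis Psi (U Phi h))).
    exact: cross_bounded_operator.
  exact: inv_frame_op_bounded.
(* Feeding [c *: h] to [N] cancels its factor [1 / c]. *)
have NZE h : N (c *: h) = inv_op SG (synthesis Psi (U Phi (inv_op SF h))).
  by rewrite bounded_operatorZr// NE scalerA mul1r divff// scale1r.
(* Once the coefficients are [U Psi k], their synthesis along [Psi] is [SG k] by definition, and
   [inv_op SG] returns [k]. *)
have NE_of k h : U Psi k = U Phi (inv_op SF h) -> N (c *: h) = k.
  by move=> Uk; rewrite NZE -Uk [LHS]SGK.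
have MN_of k h : U Psi k = U Phi (inv_op SF h) -> M (N (c *: h)) = c *: h.
  by move=> Uk; rewrite (NE_of _ _ Uk) ME Uk -[in RHS](SFKV h).
have NM_of k h : U Phi k = U Psi h -> N (M h) = h.
  by move=> Uk; rewrite ME NZE -Uk [inv_op SF _]SFK Uk [LHS]SGK.
have cK (h : H) : h = c *: (c^-1 *: h) by rewrite scalerA divff// scale1r.
have right_inv : RU Phi `<=` RU Psi -> bounded_right_inverse M N.
  move=> sub; split=> // h.
  have [|k _ Uk] := sub (U Phi (inv_op SF (c^-1 *: h))).
    by exists (inv_op SF (c^-1 *: h)).
  by rewrite (cK h); exact: MN_of Uk.
have left_inv : RU Psi `<=` RU Phi -> bounded_left_inverse M N.
  move=> sub; split=> // h.
  by have [|k _ Uk] := sub (U Psi h); [exists h|exact: NM_of Uk].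
do 2 split=> //; split; [|split].
- move=> eqR.
  have [_ MN] : bounded_right_inverse M N by apply: right_inv; rewrite eqR.
  have [_ NM] : bounded_left_inverse M N by apply: left_inv; rewrite eqR.
  split; first by split=> //; exists N.
  (* [inv_op M] cancels [M] because [M] is injective, having [N] as left inverse. *)
  apply/funext => h; rewrite -[in LHS](MN h) /inv_op pinvKV ?inE//.
  by move=> x y _ _; exact: can_inj NM x y.
- move=> [sub nsub] [_ [M' MK MK']]; apply: nsub => _ [k _ <-].
  have [_ MN] := right_inv sub.
  have NM h : N (M h) = h by apply: (can_inj MK); rewrite MN.
  (* The vector is chosen so that [NE_of] gives [N (M k) = k']. Hence [k' = k], and [U Psi k] lies
     in the range of [U Phi], against strictness. *)
  have [|k' _ Uk'] := sub (U Phi (inv_op SF (c^-1 *: M k))).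
    by exists (inv_op SF (c^-1 *: M k)).
  have := NE_of _ _ Uk'; rewrite -cK NM => ->.
  by exists (inv_op SF (c^-1 *: M k)) => //; rewrite Uk'.
- move=> [sub nsub] [_ [M' MK MK']]; apply: nsub => _ [k _ <-].
  have [_ NM] := left_inv sub.
  have MN h : M (N h) = h by rewrite -[h]MK' NM.
  (* If [U Phi k = U Psi g], then [M g = c *: SF k], so the only candidate for [g] is
     [N (c *: SF k)]. Its coefficients are those of some [k'] under [U Phi], and [M N = 1] with
     injectivity of [SF] forces [k' = k]. *)
  have [|k' _ Uk'] := sub (U Psi (N (c *: SF k))); first by exists (N (c *: SF k)).
  have : SF k' = SF k.
    have := MN (c *: SF k); rewrite ME -Uk'.
    by move/(scalerI c_neq0).
  by move/(can_inj SFK) => <-; exists (N (c *: SF k)).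
Qed.
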